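(* Let $0<p<1$ and let $k\ge 1$ be an integer. A coin showing heads (H) with probability $p$ and tails (T) with probability $1-p$ is flipped independently until the string $\mathrm{H}^k\mathrm{T}$ ($k$ heads followed by a tails) first appears as consecutive flips; let $Y$ be the number of flips. Then $E(Y^0)=1$ and for every $n\ge 1$, \[ E(Y^n) = \sum_{j=1}^{n-1} \binom{n}{j} E(Y^j) \sum_{i=1}^k \frac{(1-p)\, i^{n-j}}{p^{k-i+1}} + \sum_{i=1}^\infty \frac{(1-p)\, i^n}{p^{k-i+1}} \] \[ = \sum_{j=1}^{n-1} \binom{n}{j} E(Y^j) \sum_{i=0}^n \frac{e_{n-j,i}\, p^i - e_{n-j,i}^k\, p^{k+i+1}}{(1-p)^{n-j}p^{k+1}} + \sum_{i=0}^n \frac{e_{n,i}\,p^i}{(1-p)^n p^{k+1}}. \]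
   Context: The Eulerian numbers $e_{n,i}$ are defined by $e_{0,0}=1$, $e_{n,i}=0$ whenever $i\le 0$ (unless $n=i=0$) or $i>n$, and $e_{n,i}=i\,e_{n-1,i}+(n-i+1)\,e_{n-1,i-1}$ otherwise. For the integer parameter $k$, $e^k_{0,0}=1$, $e^k_{n,i}=0$ whenever $i<0$ or $i>n$, and $e^k_{n,i}=(k+i+1)\,e^k_{n-1,i}+(n-k-i)\,e^k_{n-1,i-1}$ otherwise. *)

(* Defs.v *)
From HB Require Import structures.
From mathcomp Require Import all_boot all_order all_algebra.
From mathcomp Require Import all_classical all_reals all_analysis.
Set Implicit Arguments. Unset Strict Implicit. Unset Printing Implicit Defensive.
Import Order.TTheory GRing.Theory Num.Theory.
Local Open Scope ring_scope.

Fixpoint eul (n i : nat) : nat :=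
  match n with
  | 0 => (i == 0)%N
  | n'.+1 => if (i == 0)%N || (n'.+1 < i)%N then 0%N
             else (i * eul n' i + (n'.+1 - i + 1) * eul n' i.-1)%N
  end.

Fixpoint eulk (k : int) (n i : nat) : int :=
  match n with
  | 0 => ((i == 0)%N)%:Z
  | n'.+1 => if (n'.+1 < i)%N then 0
             else (k + i%:Z + 1) * eulk k n' i
                  + (n'.+1%:Z - k - i%:Z) *
                    (if i is i'.+1 then eulk k n' i' else 0)
  end.

(* Coin flips: true = heads (H), false = tails (T).
   The pattern H^k T. *)
Definition HkT (k : nat) : seq bool := rcons (nseq k true) false.

(* A finite flip sequence w of length m witnesses the event {Y = m}:
   H^k T occurs (consecutively) in w but not in w with its last flip removed,
   i.e. the first occurrence of H^k T ends exactly at flip m. *)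
Definition stops_at (k : nat) (w : seq bool) : bool :=
  infix (HkT k) w && ~~ infix (HkT k) (take (size w).-1 w).

(* P(Y = m) for i.i.d. flips with P(H) = p: the probability of the cylinder
   event determined by the first m flips. *)
Definition probY {R : realType} (p : R) (k m : nat) : R :=
  \sum_(w : m.-tuple bool | stops_at k w)
     p ^+ count id w * (1 - p) ^+ count negb w.

Definition rseries {R : realType} (m : nat) (f : nat -> R) : R :=
  limn (fun N => \sum_(m <= i < N) f i).
Definition rseries_cvg {R : realType} (m : nat) (f : nat -> R) : Prop :=
  cvgn (fun N => \sum_(m <= i < N) f i).

Definition momentY {R : realType} (p : R) (k n : nat) : R :=
  rseries 0 (fun m => (m%:R) ^+ n * probY p k m).

(* Main.v *)
Require Import Defs.
From HB Require Import structures.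
From mathcomp Require Import all_boot all_order all_algebra.
From mathcomp Require Import all_classical all_reals all_analysis.
From mathcomp Require Import ring lra zify.
Import Order.TTheory GRing.Theory Num.Theory.
Import numFieldNormedType.Exports.
Local Open Scope ring_scope.

(** Condition on the position [i] of the first tails, which has probability
[(1 - p) * p ^ (i - 1)]: if [i <= k] the game restarts after [i] flips, otherwise the
pattern has just been completed. Hence [P(Y = m)] satisfies a renewal equation, and
multiplying by [m ^ n] and expanding [(m' + i) ^ n] gives a linear recursion between
the truncated moments. The total weight of the restarts is [1 - p ^ k < 1], so the
truncated moments are bounded by induction on [n], hence converge, and passing to the
limit gives the first formula.

For the closed form, [(1 - x) ^ (r + 1) * \sum_(i < s) i ^ r x ^ i] and the Eulerian
polynomials all obey [Q_(r+1) = x (1 - x) Q_r' + (r + 1) x Q_r], which proves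
[(1 - x) ^ (r + 1) * \sum_(i < s) i ^ r x ^ i
  = \sum_i e_(r,i) x ^ i - \sum_i e^(s-1)_(r,i) x ^ (s + i)];
take [s = k + 1] for the finite sums and [s -> oo] for the infinite one. *)

(** * Occurrences of the pattern after an initial run of heads *)

Lemma prefix_HkT k j w : prefix (HkT k) (nseq j true ++ false :: w) = (k == j).
Proof.
by elim: k j => [|k IH] [|j] //=; rewrite prefix0s.
Qed.

Lemma infix_HkT_nseq k j : infix (HkT k) (nseq j true) = false.
Proof.
apply/negbTE/negP => /mem_infix /(_ false).
by rewrite mem_rcons mem_head mem_nseq andbF => /(_ isT).
Qed.

(** The only tails of the pattern must follow exactly [k] heads, so no occurrence can begin within a
    run of [j < k] heads or at the tails that ends it. *)
Lemma infix_HkT_lt k j w : (j < k)%N ->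
  infix (HkT k) (nseq j true ++ false :: w) = infix (HkT k) w.
Proof.
elim: j => [|j IH] jk; last first.
  have := prefix_HkT k j.+1 w; rewrite /= => ->.
  by rewrite gtn_eqF //= IH // ltnW.
have := prefix_HkT k 0 w; rewrite /= => ->.
by rewrite gtn_eqF.
Qed.

Lemma infix_HkT_ge k j w : (k <= j)%N ->
  infix (HkT k) (nseq j true ++ false :: w).
Proof.
move=> kj; apply/infixP; exists (nseq (j - k) true), w.
by rewrite -cat_rcons catA -rcons_cat cat_nseq /ncons -iterD subnK // cat_rcons.
Qed.

Lemma stops_at_nseq k j : stops_at k (nseq j true) = false.
Proof. by rewrite /stops_at infix_HkT_nseq. Qed.

Lemma stops_at_lt k j w : (j < k)%N ->
  stops_at k (nseq j true ++ false :: w) = stops_at k w.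
Proof.
move=> jk; rewrite /stops_at infix_HkT_lt // size_cat size_nseq /= addnS /=.
case: w => [|b w]; first by rewrite (infix_HkT_nseq k 0).
rewrite take_cat size_nseq ltnNge leq_addr /= addKn /=.
by rewrite infix_HkT_lt.
Qed.

(** The pattern is complete at the first tails, so that flip must be the last one. *)
Lemma stops_at_ge k j w : (k <= j)%N ->
  stops_at k (nseq j true ++ false :: w) = (w == [::]).
Proof.
move=> kj; rewrite /stops_at infix_HkT_ge // size_cat size_nseq /= addnS /=.
rewrite take_cat size_nseq ltnNge leq_addr /= addKn /=.
case: w => [|b w] /=; first by rewrite cats0 infix_HkT_nseq.
by rewrite infix_HkT_ge.
Qed.

(** * The renewal equation for the law of [Y] *)

Lemma sum_tuple_boolS (V : nmodType) m (P : pred (seq bool)) (F : seq bool -> V) :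
  \sum_(w : m.+1.-tuple bool | P w) F w =
  \sum_(w : m.-tuple bool | P (true :: w)) F (true :: w) +
  \sum_(w : m.-tuple bool | P (false :: w)) F (false :: w).
Proof.
pose h (bw : bool * m.-tuple bool) : m.+1.-tuple bool := cons_tuple bw.1 bw.2.
rewrite (reindex h) /=; last first.
  exists (fun w => (thead w, [tuple of behead w])) => [[b w] _|w _].
    by rewrite /h /=; congr (_, _); apply/val_inj.
  by rewrite /h /= [RHS]tuple_eta.
rewrite -(pair_big_dep xpredT (fun b (w : m.-tuple bool) => P (b :: w))
  (fun b (w : m.-tuple bool) => F (b :: w))) /=.
by rewrite big_bool.
Qed.

Section Renewal.
Variables (R : realType) (p : R) (k : nat).

(* The probability that [Y = j + m], given that the first [j] flips are heads. *)
Definition probY_after (j m : nat) : R :=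
  \sum_(w : m.-tuple bool | stops_at k (nseq j true ++ w))
     p ^+ count id w * (1 - p) ^+ count negb w.

Lemma probY_after_zero j : probY_after j 0 = 0.
Proof. by apply: big1 => w; rewrite tuple0 cats0 stops_at_nseq. Qed.

(** Condition on the next flip: heads lengthens the run; tails restarts the game if [j < k] and
    otherwise ends it, which requires [m = 0]. *)
Lemma probY_afterS j m : probY_after j m.+1 = p * probY_after j.+1 m +
  (1 - p) * (if (j < k)%N then probY p k m else (m == 0)%N%:R).
Proof.
rewrite /probY_after (sum_tuple_boolS _ _ (fun w => stops_at k (nseq j true ++ w))
  (fun w => p ^+ count id w * (1 - p) ^+ count negb w)) /=; congr (_ + _).
  rewrite mulr_sumr; apply: eq_big => [w|w _]; last by rewrite add1n add0n exprS mulrA.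
  by rewrite !cat_nseq /ncons -iterSr.
under eq_bigr do rewrite add1n add0n exprS mulrCA.
rewrite -mulr_sumr; congr (_ * _).
case: ltnP => jk; first by apply: eq_bigl => w; rewrite stops_at_lt.
under eq_bigl do rewrite stops_at_ge //.
case: m => [|m]; last by apply: big1 => w; rewrite -size_eq0 size_tuple.
rewrite (big_pred1 [tuple]) /=; first by rewrite !expr0 mulr1.
by move=> w; rewrite tuple0.
Qed.

Lemma probY_after_ge j m : (k <= j)%N ->
  probY_after j m = if (0 < m)%N then (1 - p) * p ^+ m.-1 else 0.
Proof.
elim: m j => [|m IH] j kj; first exact: probY_after_zero.
rewrite probY_afterS ltnNge kj /= IH; last by rewrite leqW.
by case: m {IH} => [|m] /=; rewrite ?exprS; ring.
Qed.

(** Intermediate stage for the induction: only the first [r] flips are inspected. Here [i] counts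
    the heads before the first tails, so a restart uses up [i.+1] flips. The tests on [m] guard
    against truncated subtraction. *)
Lemma probY_after_unroll r m : (r <= k)%N -> probY p k m =
  \sum_(0 <= i < r) (1 - p) * p ^+ i * (if (i < m)%N then probY p k (m - i.+1) else 0) +
  p ^+ r * (if (r <= m)%N then probY_after r (m - r) else 0).
Proof.
elim: r => [|r IH] rk; first by rewrite big_nil subn0 expr0 mul1r add0r.
rewrite big_nat_recr //= -addrA (IH (ltnW rk)); congr (_ + _).
case: (ltngtP r m) => rm.
- by rewrite -(subnSK rm) probY_afterS rk exprS; ring.
- by rewrite !mulr0 addr0.
- by rewrite rm subnn probY_after_zero !mulr0 addr0.
Qed.

Lemma probY_renewal m : probY p k m =
  \sum_(1 <= i < k.+1) (1 - p) * p ^+ i.-1 *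
     (if (i <= m)%N then probY p k (m - i) else 0) +
  (if (k < m)%N then (1 - p) * p ^+ m.-1 else 0).
Proof.
rewrite (probY_after_unroll k m (leqnn k)) big_add1 /=; congr (_ + _).
rewrite probY_after_ge // subn_gt0.
case: (ltngtP k m) => km; rewrite ?mulr0 //.
rewrite mulrCA -exprD; congr (_ * _ ^+ _).
lia.
Qed.

Lemma probY_ge0 m : 0 <= p -> p <= 1 -> 0 <= probY p k m.
Proof.
by move=> p0 p1; apply: sumr_ge0 => w _; rewrite mulr_ge0 // exprn_ge0 // subr_ge0.
Qed.

End Renewal.

(** * Moments of solutions of a renewal equation *)

Section Moments.
Variable R : realType.
Implicit Types (a b c : nat -> R) (k n N : nat).

(** Truncation at [N] keeps every rearrangement inside finite sums; limits are taken only
    afterwards. *)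
Definition pmoment a n N : R := \sum_(0 <= m < N) m%:R ^+ n * a m.

Lemma pmoment_nondecreasing a n : (forall m, 0 <= a m) ->
  {homo pmoment a n : x y / (x <= y)%N >-> x <= y}.
Proof.
move=> a0 x y xy; rewrite /pmoment (big_cat_nat (leq0n x) xy) /= lerDl.
by apply: sumr_ge0 => m _; rewrite mulr_ge0 // exprn_ge0.
Qed.

Lemma pmoment_shift a n N i :
  \sum_(0 <= m < N) m%:R ^+ n * (if (i <= m)%N then a (m - i)%N else 0) =
  \sum_(j < n.+1) 'C(n, j)%:R * i%:R ^+ (n - j) * pmoment a j (N - i).
Proof.
transitivity (\sum_(0 <= m < N - i) (i%:R + m%:R) ^+ n * a m).
  transitivity (\sum_(0 + i <= m < N) m%:R ^+ n * a (m - i)%N).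
    rewrite add0n (big_nat_widenl i 0) // [RHS]big_mkcond /=.
    by apply: eq_bigr => m _; case: ifP => //; rewrite mulr0.
  by rewrite big_addn; apply: eq_bigr => m _; rewrite addnK natrD addrC.
under eq_bigr do rewrite exprDn mulr_suml.
rewrite exchange_big /=; apply: eq_bigr => j _.
rewrite /pmoment mulr_sumr; apply: eq_bigr => m _.
by rewrite -mulr_natl !mulrA.
Qed.

(** The weight [c i] belongs to a restart after [i] steps, and [b] is the source term. Both
    [probY p k] and the powers of [p] solve such an equation. *)
Definition renewal k c b a := forall m, a m =
  \sum_(1 <= i < k.+1) c i * (if (i <= m)%N then a (m - i)%N else 0) + b m.

Section RenewalEquation.
Variables (k : nat) (a b c : nat -> R).
Hypothesis renewal_a : renewal k c b a.

Lemma pmoment_renewal n N : pmoment a n N =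
  \sum_(1 <= i < k.+1) c i *
    (\sum_(j < n.+1) 'C(n, j)%:R * i%:R ^+ (n - j) * pmoment a j (N - i)) +
  pmoment b n N.
Proof.
rewrite {1}/pmoment; under eq_bigr do rewrite renewal_a mulrDr mulr_sumr.
rewrite big_split /=; congr (_ + _).
rewrite exchange_big /=; apply: eq_bigr => i _.
rewrite -pmoment_shift mulr_sumr; apply: eq_bigr => m _; ring.
Qed.

Hypothesis a_ge0 : forall m, 0 <= a m.
Hypothesis b_ge0 : forall m, 0 <= b m.
Hypothesis c_ge0 : forall i, 0 <= c i.
Hypothesis c_lt1 : \sum_(1 <= i < k.+1) c i < 1.
Hypothesis cvg_b : forall n, cvgn (pmoment b n).

(* The top-order term of the renewal equation carries the factor [\sum c i < 1],
   so it can be absorbed into the left-hand side. *)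
Lemma pmoment_renewal_bounded n : exists B, forall N, pmoment a n N <= B.
Proof.
elim/ltn_ind: n => n IH.
have /choice[Bf HB] j : exists B, (j < n)%N -> forall N, pmoment a j N <= B.
  have [jn|] := boolP (j < n)%N; last by exists 0.
  by have [B HB] := IH j jn; exists B.
pose S := \sum_(1 <= i < k.+1) c i.
(* This bound [B] solves [B = L + S * B], where [L] collects the moments of order below [n] and the
   limit of the source term. *)
exists ((\sum_(1 <= i < k.+1) c i *
  (\sum_(j < n) 'C(n, j)%:R * i%:R ^+ (n - j) * Bf j) +
  limn (pmoment b n)) / (1 - S)) => N.
rewrite ler_pdivlMr ?subr_gt0 // mulrBr mulr1 lerBlDr.
rewrite {1}pmoment_renewal addrAC lerD //; last first.
  exact: (nondecreasing_cvgn_le (pmoment_nondecreasing _ _ b_ge0)).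
rewrite mulrC /S mulr_suml -big_split /=; apply: ler_sum => i _.
rewrite -mulrDr; apply: ler_wpM2l; first exact: c_ge0.
(* The term [j = n] has coefficient 1, and monotonicity replaces [N - i] by [N] in it. *)
rewrite big_ord_recr /= binn subnn expr0 !mul1r lerD //; last first.
  by apply: pmoment_nondecreasing; rewrite ?leq_subr.
apply: ler_sum => j _; apply: ler_wpM2l; last exact: HB.
by rewrite mulr_ge0 // exprn_ge0.
Qed.

Lemma is_cvg_pmoment_renewal n : cvgn (pmoment a n).
Proof.
apply: nondecreasing_is_cvgn; first exact: pmoment_nondecreasing.
by have [B HB] := pmoment_renewal_bounded n; exists B => _ [N _ <-].
Qed.

Lemma lim_pmoment_renewal n : limn (pmoment a n) =
  \sum_(1 <= i < k.+1) c i *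
    (\sum_(j < n.+1) 'C(n, j)%:R * i%:R ^+ (n - j) * limn (pmoment a j)) +
  limn (pmoment b n).
Proof.
apply: cvg_lim => //.
rewrite (funext (pmoment_renewal n)).
apply: cvgD; last exact: cvg_b.
apply: (cvg_big add_continuous) => i _; apply: cvgMl_tmp.
apply: (cvg_big add_continuous) => j _; apply: cvgMl_tmp.
by rewrite (cvg_centern i (pmoment a j)); apply: is_cvg_pmoment_renewal.
Qed.

End RenewalEquation.
End Moments.

(** * Eulerian polynomials and finite power sums *)

Section Eulerian.

Lemma eulk_gt k n i : (n < i)%N -> eulk k n i = 0.
Proof. by case: n => [|n] /=; [case: i | move=> ->]. Qed.

Lemma eulkS k n i : eulk k n.+1 i = (k + i%:Z + 1) * eulk k n i +
  (n.+1%:Z - k - i%:Z) * (if i is i'.+1 then eulk k n i' else 0).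
Proof.
rewrite /=; case: ltnP => // ni.
by case: i ni => // i ni; rewrite !eulk_gt ?mulr0 //; lia.
Qed.

(** At [k = -1] the two recursions have the same coefficients, so only the family [eulk] has to be
    studied. *)
Lemma eul_eulk n i : (eul n i)%:Z = eulk (-1) n i.
Proof.
elim: n i => [|n IH] [|i] //=; first by rewrite addr0 addNr mul0r mulr0.
case: ltnP => // ni.
by rewrite PoszD !PoszM !IH /=; congr (_ * _ + _ * _); lia.
Qed.

Variable R : comNzRingType.
Implicit Types (s r : nat) (P : {poly R}).

(** With the parameter shifted by one, [s = 0] gives the classical Eulerian polynomial and
    [s = k.+1] the one attached to [eulk k]. *)
Definition eulk_poly s r : {poly R} :=
  \sum_(0 <= i < r.+1) (eulk (s%:Z - 1) r i)%:~R *: 'X^(s + i).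

(** This is the effect of [x * d/dx] on the numerator of [P / (1 - x) ^ (r + 1)] when the result is
    written over [(1 - x) ^ (r + 2)]. *)
Definition eul_step r P : {poly R} := 'X * (1 - 'X) * P^`() + r.+1%:R *: ('X * P).

Lemma eul_step_Xn r e : eul_step r 'X^e =
  e%:R *: 'X^e + (r.+1%:R - e%:R) *: 'X^(e.+1).
Proof.
rewrite /eul_step derivXn -mulr_natl -!mul_polyC !rmorphB !rmorph_nat.
by case: e => [|e] /=; rewrite ?exprS; ring.
Qed.

Lemma eul_step_sum r (I : Type) (t : seq I) (c : I -> R) (P : I -> {poly R}) :
  eul_step r (\sum_(i <- t) c i *: P i) = \sum_(i <- t) c i *: eul_step r (P i).
Proof.
rewrite /eul_step raddf_sum !mulr_sumr scaler_sumr -big_split /=.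
apply: eq_bigr => i _.
by rewrite derivZ -!scalerAr scalerDr !scalerA [c i * _]mulrC.
Qed.

(** On ['X^(s + i)] the operator produces the weights [s + i] and [r + 1 - s - i], exactly those
    with which [eulk (s - 1) r i] enters the entries [i] and [i + 1] of the next row. *)
Lemma eulk_polyS s r : eulk_poly s r.+1 = eul_step r (eulk_poly s r).
Proof.
rewrite /eulk_poly eul_step_sum.
under [RHS]eq_bigr do rewrite eul_step_Xn scalerDr !scalerA -addnS.
rewrite big_split.
under [LHS]eq_bigr do rewrite eulkS rmorphD !rmorphM scalerDl.
rewrite [LHS]big_split /=; congr (_ + _).
  rewrite big_nat_recr //= eulk_gt // mulr0 scale0r addr0.
  apply: eq_bigr => i _; congr (_ *: _); rewrite mulrC; congr (_ * _).
  by rewrite pmulrn; congr (_%:~R); lia.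
rewrite big_nat_recl //= mulr0 scale0r add0r.
apply: eq_bigr => i _; congr (_ *: _); rewrite mulrC; congr (_ * _).
by rewrite !pmulrn -rmorphB; congr (_%:~R); lia.
Qed.

Definition powsum_poly s r : {poly R} := \sum_(0 <= i < s) i%:R ^+ r *: 'X^i.

Lemma powsum_polyS s r : powsum_poly s r.+1 = 'X * (powsum_poly s r)^`().
Proof.
rewrite /powsum_poly raddf_sum mulr_sumr; apply: eq_bigr => i _ /=.
rewrite derivZ derivXn -scalerAr exprSr -scalerA; congr (_ *: _).
by case: i => [|i]; rewrite ?mulr0n ?scale0r ?mulr0 //= scaler_nat mulrnAr -exprS.
Qed.

Lemma powsum_polyE s r :
  (1 - 'X) ^+ r.+1 * powsum_poly s r = eulk_poly 0 r - eulk_poly s r.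
Proof.
elim: r => [|r IH].
  (* For [r = 0] this is the finite geometric sum; the term [i = 0] counts because [0 ^+ 0 = 1]. *)
  rewrite /eulk_poly !big_nat1 /= !addn0 !scale1r expr0 expr1 /powsum_poly.
  rewrite big_mkord -[1 in RHS](expr1n _ s) subrXX; congr (_ * _).
  by apply: eq_bigr => i _; rewrite scale1r expr1n mul1r.
rewrite !eulk_polyS powsum_polyS.
have -> : eul_step r (eulk_poly 0 r) - eul_step r (eulk_poly s r) =
  eul_step r (eulk_poly 0 r - eulk_poly s r).
  by rewrite /eul_step derivB -!mul_polyC; ring.
have d1 : (1 : {poly R})^`() = 0 by rewrite -polyC1 derivC.
rewrite -IH /eul_step derivM deriv_exp derivB derivX d1 -mul_polyC.
rewrite /= [in LHS]exprS [in LHS]exprS ?exprS -mulr_natr polyC_natr.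
by ring.
Qed.
End Eulerian.

(** * The series of [m ^ n * p ^ m] *)

Section GeometricMoments.
Local Open Scope classical_set_scope.
Local Open Scope ring_scope.
Variables (R : realType) (p : R).
Hypotheses (p_gt0 : 0 < p) (p_lt1 : p < 1).

Local Notation geom := (fun m : nat => p ^+ m).

(** This makes the general convergence result for renewal equations apply to the geometric
    sequence. *)
Lemma renewal_geom : renewal R 1 (fun=> p) (fun m => (m == 0)%N%:R) geom.
Proof.
move=> m; rewrite big_nat1; case: m => [|m] /=; first by rewrite mulr0 add0r.
by rewrite subn1 addr0 -exprS.
Qed.

Lemma is_cvg_geom_moment n : cvgn (pmoment R geom n).
Proof.
apply: (is_cvg_pmoment_renewal _ _ _ _ _ renewal_geom) => //.
- by move=> m; rewrite exprn_ge0 // ltW.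
- by move=> _; rewrite ltW.
- by rewrite big_nat1.
(* The source is concentrated at 0, so its truncated moments equal [0 ^+ n] from [N = 1] on; the
   shift skips the empty sum. *)
move=> {}n; apply/cvg_ex; exists (0 ^+ n); rewrite -cvg_shiftS /=.
rewrite (_ : (fun _ => _) = fun=> 0 ^+ n); first exact: cvg_cst.
apply/funext => N; rewrite /pmoment big_nat_recl //= mulr1 big1 ?addr0 // => i _.
by rewrite mulr0.
Qed.

(** For fixed [r] and [i] the number [eulk (s - 1) r i] is polynomial in [s], so [p ^+ s] dominates
    it. The exponent [a] is kept general to absorb the factor [s] created by each step of the
    recursion. *)
Lemma cvg_eulk_geom a r i :
  (fun s : nat => s%:R ^+ a * (eulk (s%:Z - 1) r i)%:~R * p ^+ s) @ \oo --> (0 : R).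
Proof.
elim: r i a => [|r IH] i a /=.
  rewrite (_ : (fun _ => _) = fun s : nat => (i == 0%N)%:R * (s%:R ^+ a * p ^+ s)); last first.
    by apply/funext => s; rewrite -pmulrn; ring.
  rewrite -(mulr0 (i == 0%N)%:R); apply: cvgMl_tmp.
  exact: (cvg_series_cvg_0 (is_cvg_geom_moment a)).
pose t i a (s : nat) : R := s%:R ^+ a * (eulk (s%:Z - 1) r i)%:~R * p ^+ s.
pose u i := if i is i'.+1 then t i' else fun=> fun=> 0.
have cvg_u j b : u j b @ \oo --> (0 : R) by case: j => [|j]; [exact: cvg_cst | exact: IH].
rewrite (_ : (fun _ => _) = fun s : nat =>
  (t i a.+1 s + i%:R * t i a s) + ((r.+2%:R - i%:R) * u i a s - u i a.+1 s)); last first.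
  apply/funext => s; rewrite -[if _ then _ else _]/(eulk (s%:Z - 1) r.+1 i) eulkS.
  rewrite /u /t !(intrD, intrM, intrB, rmorphN, rmorph1) /= -!pmulrn.
  by case: i => [|i]; rewrite !exprS; ring.
rewrite [X in _ --> X](_ : 0 = (0 + i%:R * 0) + ((r.+2%:R - i%:R) * 0 - 0)); last by ring.
apply: cvgD; first by apply: cvgD; [exact: IH | apply: cvgMl_tmp; exact: IH].
by apply: cvgB; [apply: cvgMl_tmp; exact: cvg_u | exact: cvg_u].
Qed.

Lemma horner_eulk_poly s r :
  (eulk_poly R s r).[p] = \sum_(0 <= i < r.+1) (eulk (s%:Z - 1) r i)%:~R * p ^+ (s + i).
Proof.
by rewrite /eulk_poly horner_sum; apply: eq_bigr => i _; rewrite hornerZ hornerXn.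
Qed.

Lemma horner_eul_poly r :
  (eulk_poly R 0 r).[p] = \sum_(0 <= i < r.+1) (eul r i)%:R * p ^+ i.
Proof.
rewrite horner_eulk_poly; apply: eq_bigr => i _.
by rewrite add0r -eul_eulk -pmulrn.
Qed.

Lemma geom_moment_eulk n N :
  pmoment R geom n N = ((eulk_poly R 0 n).[p] - (eulk_poly R N n).[p]) / (1 - p) ^+ n.+1.
Proof.
have q0 : (1 - p) ^+ n.+1 != 0 by rewrite expf_neq0 // gt_eqF // subr_gt0.
apply: (mulfI q0); rewrite [RHS]mulrC divfK //.
rewrite -hornerN -hornerD -powsum_polyE hornerM horner_exp !hornerE; congr (_ * _).
rewrite /powsum_poly horner_sum; apply: eq_bigr => i _.
by rewrite hornerZ hornerXn.
Qed.

Lemma cvg_geom_moment n :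
  pmoment R geom n @ \oo --> (\sum_(0 <= i < n.+1) (eul n i)%:R * p ^+ i) / (1 - p) ^+ n.+1.
Proof.
rewrite -horner_eul_poly (funext (geom_moment_eulk n)).
apply: cvgMr_tmp; rewrite -[X in _ --> X]subr0; apply: cvgB; first exact: cvg_cst.
rewrite [X in _ --> X](_ : 0 = \sum_(0 <= i < n.+1) (0 : R)); last by rewrite big1.
rewrite (funext (horner_eulk_poly ^~ n)).
apply: (cvg_big add_continuous) => i _.
rewrite (_ : (fun _ => _) = fun s : nat =>
  p ^+ i * (s%:R ^+ 0 * (eulk (s%:Z - 1) n i)%:~R * p ^+ s)); last first.
  by apply/funext => s; rewrite exprD; ring.
by rewrite -(mulr0 (p ^+ i)); apply: cvgMl_tmp; apply: cvg_eulk_geom.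
Qed.

End GeometricMoments.

(** * The moments of [Y] *)

Section FirstOccurrence.
Local Open Scope classical_set_scope.
Local Open Scope ring_scope.
Variables (R : realType) (p : R) (k : nat).
Hypotheses (p_gt0 : 0 < p) (p_lt1 : p < 1).

Local Notation geom := (fun m : nat => p ^+ m).
Local Notation first_tail := (fun i : nat => (1 - p) * p ^+ i.-1).
Local Notation late_tail :=
  (fun m : nat => if (k < m)%N then (1 - p) * p ^+ m.-1 else 0).

Lemma sum_first_tail : \sum_(1 <= i < k.+1) first_tail i = 1 - p ^+ k.
Proof.
rewrite big_add1 /= -mulr_sumr -[1 in RHS](expr1n _ k) subrXX big_mkord.
by congr (_ * _); apply: eq_bigr => i _; rewrite expr1n mul1r.
Qed.

(** Positivity of [n] makes the term at 0 vanish. *)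
Lemma sum_pow_geom n N : (0 < n)%N ->
  \sum_(1 <= i < N) i%:R ^+ n * p ^+ i = pmoment R geom n N.
Proof.
move=> n0; rewrite /pmoment; case: N => [|N]; first by rewrite !big_geq.
by rewrite [RHS]big_ltn //= expr0n gtn_eqF // mul0r add0r.
Qed.

Lemma first_tailE i : (0 < i)%N -> first_tail i = (1 - p) / p * p ^+ i.
Proof. by case: i => // i _ /=; rewrite exprS mulrA divfK // gt_eqF. Qed.

Lemma sum_pow_first_tail n : (0 < n)%N ->
  \sum_(1 <= i < k.+1) first_tail i * i%:R ^+ n =
  (1 - p) / p * pmoment R geom n k.+1.
Proof.
move=> n0; rewrite -sum_pow_geom // mulr_sumr; apply: eq_big_nat => i /andP[i0 _].
by rewrite first_tailE // -mulrA [p ^+ i * _]mulrC.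
Qed.

(** The exponent is negative once [i > k.+1], hence integer powers; the ratio is
    [p ^+ i / p ^+ k.+1]. *)
Lemma sum_pow_ratio n N : (0 < n)%N ->
  \sum_(1 <= i < N) (1 - p) * i%:R ^+ n / p ^ (k%:Z - i%:Z + 1) =
  (1 - p) / p ^+ k.+1 * pmoment R geom n N.
Proof.
move=> n0; rewrite -sum_pow_geom // mulr_sumr; apply: eq_big_nat => i _.
have p0 : p != 0 by rewrite gt_eqF.
rewrite addrAC expfzDr // -invr_expz invfM invrK.
rewrite (_ : p ^ (k%:Z + 1) = p ^+ k.+1); last by rewrite -addn1 -PoszD.
rewrite (_ : p ^ i%:Z = p ^+ i) //; ring.
Qed.

Lemma pmoment_late_tail n N : (k < N)%N -> pmoment R late_tail n N =
  (1 - p) / p * (pmoment R geom n N - pmoment R geom n k.+1).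
Proof.
move=> kN; rewrite /pmoment !(big_cat_nat (leq0n k.+1) kN) /= addrAC subrr add0r.
rewrite [X in X + _]big_nat big1 ?add0r; last first.
  by move=> i /andP[_ ik]; rewrite ltnNge -ltnS ik mulr0.
rewrite mulr_sumr; apply: eq_big_nat => i /andP[ki _].
by rewrite ki first_tailE 1?mulrCA // (leq_ltn_trans _ ki).
Qed.

Lemma cvg_late_tail n : pmoment R late_tail n @ \oo -->
  (1 - p) / p * ((\sum_(0 <= i < n.+1) (eul n i)%:R * p ^+ i) / (1 - p) ^+ n.+1
                 - pmoment R geom n k.+1).
Proof.
apply: (@cvg_trans _ ((fun N => (1 - p) / p *
    (pmoment R geom n N - pmoment R geom n k.+1)) @ \oo)).
  apply: near_eq_cvg; exists k.+1 => // N /= kN.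
  by rewrite pmoment_late_tail.
apply: cvgMl_tmp; apply: cvgB; last exact: cvg_cst.
exact: cvg_geom_moment.
Qed.

Let q_gt0 : 0 < 1 - p.
Proof. by rewrite subr_gt0. Qed.

Let ge0_first_tail i : 0 <= first_tail i.
Proof. by rewrite mulr_ge0 ?exprn_ge0 // ltW. Qed.

Let ge0_late_tail i : 0 <= late_tail i.
Proof. by rewrite /=; case: ifP => // _; apply: ge0_first_tail. Qed.

Let sum_first_tail_lt1 : \sum_(1 <= i < k.+1) first_tail i < 1.
Proof. by rewrite sum_first_tail ltrBlDr ltrDl exprn_gt0. Qed.

Let probY_nonneg m : 0 <= probY p k m.
Proof. by rewrite probY_ge0 // ltW. Qed.

Let is_cvg_late_tail n : cvgn (pmoment R late_tail n).
Proof. by apply/cvg_ex; eexists; apply: cvg_late_tail. Qed.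

Lemma is_cvg_momentY n : cvgn (pmoment R (probY p k) n).
Proof.
exact: (is_cvg_pmoment_renewal _ _ _ _ _ (@probY_renewal R p k)).
Qed.

Lemma momentY_renewal n : momentY p k n =
  \sum_(j < n.+1) 'C(n, j)%:R * momentY p k j *
     (\sum_(1 <= i < k.+1) first_tail i * i%:R ^+ (n - j)) +
  (1 - p) / p * ((\sum_(0 <= i < n.+1) (eul n i)%:R * p ^+ i) / (1 - p) ^+ n.+1
                 - pmoment R geom n k.+1).
Proof.
rewrite {1}/momentY {1}/rseries -/(pmoment R (probY p k) n).
rewrite (lim_pmoment_renewal _ _ _ _ _ (@probY_renewal R p k)) //.
congr (_ + _); last by apply: cvg_lim => //; apply: cvg_late_tail.
under eq_bigr do rewrite mulr_sumr.
rewrite exchange_big /=; apply: eq_bigr => j _.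
rewrite mulr_sumr; apply: eq_bigr => i _.
rewrite /momentY /rseries -/(pmoment R (probY p k) j); ring.
Qed.

(** At order 0 the recursion reads [M = M * (1 - p ^+ k) + p ^+ k]. *)
Lemma momentY0 : momentY p k 0 = 1.
Proof.
have := momentY_renewal 0; rewrite big_ord1 bin0 mul1r subnn.
under eq_bigr do rewrite expr0 mulr1.
rewrite sum_first_tail geom_moment_eulk // horner_eul_poly horner_eulk_poly.
rewrite !big_nat1 /= addn0 !expr0 !expr1 !mul1r => e.
have pk0 : p ^+ k != 0 by rewrite expf_neq0 // gt_eqF.
apply: (mulIf pk0); rewrite mul1r.
rewrite [RHS](_ : _ = (1 - p) / p * ((1 - p)^-1 - (1 - p ^+ k.+1) / (1 - p))); last first.
  by rewrite exprS; field; rewrite !gt_eqF.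
move: e; set t := (1 - p) / p * _; lra.
Qed.

(** In [momentY_renewal] the term [j = 0] cancels the finite geometric moment subtracted in the
    source. The term [j = n] has weight [1 - p ^+ k]; moving it to the left and dividing by [p ^+ k]
    turns [1 / p] into [1 / p ^+ k.+1]. *)
Lemma momentY_rec n : (0 < n)%N -> momentY p k n =
  \sum_(1 <= j < n) 'C(n, j)%:R * momentY p k j *
     ((1 - p) / p ^+ k.+1 * pmoment R geom (n - j) k.+1) +
  (1 - p) / p ^+ k.+1 * ((\sum_(0 <= i < n.+1) (eul n i)%:R * p ^+ i) / (1 - p) ^+ n.+1).
Proof.
move=> n0; have := momentY_renewal n.
rewrite -(big_mkord xpredT (fun j => 'C(n, j)%:R * momentY p k j *
     (\sum_(1 <= i < k.+1) first_tail i * i%:R ^+ (n - j)))).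
rewrite big_nat_recr //= big_ltn //= bin0 binn subn0 subnn momentY0 !mul1r.
have -> : \sum_(1 <= i < k.+1) first_tail i * i%:R ^+ 0 = 1 - p ^+ k.
  by rewrite -sum_first_tail; apply: eq_bigr => i _; rewrite expr0 mulr1.
rewrite sum_pow_first_tail //.
rewrite (eq_big_nat _ _ (F2 := fun j => p ^+ k * ('C(n, j)%:R * momentY p k j *
     ((1 - p) / p ^+ k.+1 * pmoment R geom (n - j) k.+1)))); last first.
  move=> j /andP[_ jn]; rewrite sum_pow_first_tail ?subn_gt0 // exprS.
  by field; rewrite !gt_eqF // exprn_gt0.
rewrite -mulr_sumr; set A := \sum_(1 <= j < n) _; set B := _ / (1 - p) ^+ _.
have pk0 : p ^+ k != 0 by rewrite expf_neq0 // gt_eqF.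
have -> : (1 - p) / p ^+ k.+1 = (1 - p) / p / p ^+ k by rewrite exprS invfM mulrA.
have p0 : p != 0 by rewrite gt_eqF.
move=> e; apply: (mulfI pk0); rewrite mulrDr.
rewrite [X in _ = _ + X](_ : _ = (1 - p) / p * B); last by field; rewrite ?pk0 ?p0.
lra.
Qed.

End FirstOccurrence.

(** * Closed forms and the final statement *)

Lemma sum_eul_widen (R : realType) (p : R) r n : (r <= n)%N ->
  \sum_(0 <= i < n.+1) (eul r i)%:R * p ^+ i =
  \sum_(0 <= i < r.+1) (eul r i)%:R * p ^+ i.
Proof.
move=> rn; rewrite (big_cat_nat (leq0n r.+1) _) //= [X in _ + X]big_nat [X in _ + X]big1 ?addr0 //.
move=> i /andP[ri _]; rewrite (_ : eul r i = 0%N) ?mul0r //.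
by apply/eqP; rewrite -eqz_nat eul_eulk eulk_gt.
Qed.

Lemma sum_eulk_widen (R : realType) (p : R) (k r n : nat) : (r <= n)%N ->
  \sum_(0 <= i < n.+1) (eulk k%:Z r i)%:~R * p ^+ (k + i + 1) =
  \sum_(0 <= i < r.+1) (eulk k%:Z r i)%:~R * p ^+ (k.+1 + i).
Proof.
move=> rn; rewrite (big_cat_nat (leq0n r.+1) _) //= [X in _ + X]big_nat [X in _ + X]big1 ?addr0 //.
  by apply: eq_bigr => i _; rewrite addn1 addSn.
by move=> i /andP[ri _]; rewrite eulk_gt // mul0r.
Qed.

Lemma geom_moment_eul (R : realType) (p : R) k r n : 0 < p -> p < 1 -> (r <= n)%N ->
  (1 - p) / p ^+ k.+1 * pmoment R (fun m => p ^+ m) r k.+1 =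
  \sum_(0 <= i < n.+1)
    ((eul r i)%:R * p ^+ i - (eulk k%:Z r i)%:~R * p ^+ (k + i + 1))
    / ((1 - p) ^+ r * p ^+ (k + 1)).
Proof.
move=> p0 p1 rn; rewrite -mulr_suml sumrB sum_eul_widen // sum_eulk_widen //.
rewrite geom_moment_eulk // horner_eul_poly horner_eulk_poly.
rewrite (_ : k.+1%:Z - 1 = k%:Z); last by lia.
have p0' : p != 0 by rewrite gt_eqF.
have q0 : 1 - p != 0 by rewrite gt_eqF // subr_gt0.
rewrite addn1 [(1 - p) ^+ r.+1]exprS.
by field; rewrite q0 !expf_neq0.
Qed.

Theorem theorem3p4 (R : realType) (p : R) (k : nat) :
  0 < p -> p < 1 -> (1 <= k)%N ->
  (forall n : nat, rseries_cvg 0 (fun m => (m%:R : R) ^+ n * probY p k m)) /\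
  momentY p k 0 = 1 /\
  forall n : nat, (1 <= n)%N ->
    rseries_cvg 1 (fun i => (1 - p) * (i%:R) ^+ n / p ^ (k%:Z - i%:Z + 1)) /\
    momentY p k n =
      \sum_(1 <= j < n) ('C(n, j))%:R * momentY p k j *
         \sum_(1 <= i < k.+1) (1 - p) * (i%:R) ^+ (n - j) / p ^ (k%:Z - i%:Z + 1)
      + rseries 1 (fun i => (1 - p) * (i%:R) ^+ n / p ^ (k%:Z - i%:Z + 1)) /\
    momentY p k n =
      \sum_(1 <= j < n) ('C(n, j))%:R * momentY p k j *
         \sum_(0 <= i < n.+1)
            ((eul (n - j) i)%:R * p ^+ i
             - (eulk k%:Z (n - j) i)%:~R * p ^+ (k + i + 1))
            / ((1 - p) ^+ (n - j) * p ^+ (k + 1))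
      + \sum_(0 <= i < n.+1) (eul n i)%:R * p ^+ i
            / ((1 - p) ^+ n * p ^+ (k + 1)).
Proof.
move=> p_gt0 p_lt1 _; split; first by move=> n; exact: is_cvg_momentY.
split; first exact: momentY0.
move=> n n_gt0.
(* One limit serves three purposes: convergence of the series, its value in the first formula, and
   the last sum of the second. *)
have cvgT : ((fun N => \sum_(1 <= i < N) (1 - p) * i%:R ^+ n / p ^ (k%:Z - i%:Z + 1)) @ \oo -->
  (1 - p) / p ^+ k.+1 *
    ((\sum_(0 <= i < n.+1) (eul n i)%:R * p ^+ i) / (1 - p) ^+ n.+1))%classic.
  rewrite (funext (fun N => sum_pow_ratio R p k p_gt0 n N n_gt0)).
  by apply: cvgMl_tmp; apply: cvg_geom_moment.
split; first by apply/cvg_ex; eexists; exact: cvgT.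
rewrite /rseries (cvg_lim _ cvgT) //; split; rewrite {1}momentY_rec //.
  congr (_ + _); apply: eq_big_nat => j /andP[_ jn].
  by rewrite sum_pow_ratio // subn_gt0.
congr (_ + _).
  by apply: eq_big_nat => j _; rewrite (@geom_moment_eul _ _ _ _ n) // leq_subr.
rewrite -mulr_suml addn1 [(1 - p) ^+ n.+1]exprS.
by field; rewrite !gt_eqF // ?exprn_gt0 // subr_gt0.
Qed.
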